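(* Consider a $\sqrt{n}\times\sqrt{n}$ torus grid of $n$ servers and a library of $K$ files $W_1,\dots,W_K$ with popularity distribution $\mathcal{P}=\{p_1,\dots,p_K\}$. Each server independently caches $M$ files, drawn independently from $\mathcal{P}$ with replacement, where $M=o(K)$. Requests originate at uniformly random servers and request file $W_j$ with probability $p_j$. Under the Nearest Replica Strategy (Strategy I): if $\mathcal{P}$ is Uniform ($p_j=1/K$), the communication cost is $C=\Theta(\sqrt{K/M})$; if $\mathcal{P}$ is Zipf with parameter $\gamma>0$ and $M=\Theta(1)$, then $C=\Theta(\sqrt{K/M})$ for $0<\gamma<1$; $C=\Theta(\sqrt{K/(M\log K)})$ for $\gamma=1$; $C=\Theta(K^{1-\gamma/2}/\sqrt{M})$ for $1<\gamma<2$; $C=\Theta(\log K/\sqrt{M})$ for $\gamma=2$; and $C=\Theta(1/\sqrt{M})$ for $\gamma>2$.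
   Context: Zipf distribution with parameter $\gamma$: $p_i=i^{-\gamma}/\sum_{j=1}^K j^{-\gamma}$. Strategy I (Nearest Replica Strategy): each request is assigned to the nearest server, in graph shortest-path distance, that has cached the requested file; ties broken randomly. The communication cost $C$ is the average number of hops (shortest-path distance) between the requesting node and the serving node.
   Formalization: Added, since C is at most the diameter: n·M·p_j stays bounded below over all files (Uniform and Zipf γ<2), and log K = O(log n) for γ=2; C is the expected hop count conditional on the requested file being cached by some server; K and M are functions of n, with M≥1. *)

(* Defs.v *)
From HB Require Import structures.
From mathcomp Require Import all_boot all_order all_algebra.
From mathcomp Require Import all_classical all_reals all_analysis.

Set Implicit Arguments.
Unset Strict Implicit.
Unset Printing Implicit Defensive.

Import Order.TTheory GRing.Theory Num.Theory.
Import numFieldNormedType.Exports.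

Local Open Scope classical_set_scope.
Local Open Scope ring_scope.

(* Shortest-path distance: the least k such that some e-path with k edges goes
   from u to v; it is #|T| when v cannot be reached from u. *)
Definition gdist (T : finType) (e : rel T) (u v : T) : nat :=
  find (fun k => [exists p : k.-tuple T, path e u p && (last u p == v)])
       (iota 0 #|T|).

(* The s x s torus grid, with n = s ^ 2 servers. *)
Definition server (s : nat) : finType := ('I_s * 'I_s)%type.

Definition cycle_adj (s : nat) : rel 'I_s :=
  fun i j => (ordS i == j) || (ordS j == i).

Definition torus_adj (s : nat) : rel (server s) :=
  fun u v => (u.1 == v.1) && cycle_adj u.2 v.2
          || cycle_adj u.1 v.1 && (u.2 == v.2).

Definition hops (s : nat) (u v : server s) : nat := gdist (@torus_adj s) u v.

(* The file W_(j+1) of the library is represented by j : 'I_K. *)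
Definition uniform_pop (R : realType) (K : nat) (j : 'I_K) : R := K%:R^-1.

Definition zipf_pop (R : realType) (gamma : R) (K : nat) (j : 'I_K) : R :=
  j.+1%:R `^ (- gamma) / \sum_(i < K) i.+1%:R `^ (- gamma).

(* x v m is the file held in the m-th cache slot of server v; a file may occupy
   several slots, since the slots are drawn with replacement. *)
Definition placement (s K M : nat) : finType :=
  {ffun server s -> {ffun 'I_M -> 'I_K}}.

Definition placement_prob (R : realType) (s K M : nat) (p : 'I_K -> R)
    (x : placement s K M) : R :=
  \prod_(v : server s) \prod_(m < M) p (x v m).

Definition replicas (s K M : nat) (x : placement s K M) (j : 'I_K) :
    {set server s} :=
  [set v | [exists m, x v m == j]].

Definition nearest_replicas (s K M : nat) (x : placement s K M)
    (u : server s) (j : 'I_K) : {set server s} :=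
  [set v in replicas x j | [forall w in replicas x j, hops u v <= hops u w]%N].

(* Probability that the Nearest Replica Strategy assigns to v a request for j
   issued at u: ties are broken uniformly at random. It vanishes for every v
   when no server has cached j. *)
Definition assign_prob (R : realType) (s K M : nat) (x : placement s K M)
    (u : server s) (j : 'I_K) (v : server s) : R :=
  (v \in nearest_replicas x u j)%:R / #|nearest_replicas x u j|%:R.

(* Probability that the placement is x, and that a request is issued at u, asks
   for j and is assigned to v. *)
Definition outcome_prob (R : realType) (s K M : nat) (p : 'I_K -> R)
    (x : placement s K M) (u : server s) (j : 'I_K) (v : server s) : R :=
  placement_prob p x * #|server s|%:R^-1 * p j * assign_prob R x u j v.

(* The total mass of outcome_prob: it is smaller than 1 as the requested file
   may have been cached by no server at all. *)
Definition served_prob (R : realType) (s K M : nat) (p : 'I_K -> R) : R :=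
  \sum_(x : placement s K M) \sum_(u : server s) \sum_(j < K)
    \sum_(v : server s) outcome_prob p x u j v.

(* Expected number of hops between the requesting and the serving node,
   conditionally on there being a serving node. *)
Definition comm_cost (R : realType) (s K M : nat) (p : 'I_K -> R) : R :=
  (\sum_(x : placement s K M) \sum_(u : server s) \sum_(j < K)
     \sum_(v : server s) outcome_prob p x u j v * (hops u v)%:R)
  / served_prob s M p.

(* n M p_j is the expected number of cache slots of the network that hold j; it
   is required to stay bounded away from 0, uniformly in j, as n grows. *)
Definition library_replicated (R : realType) (p : forall K : nat, 'I_K -> R)
    (K M : nat -> nat) : Prop :=
  exists2 c : R, 0 < c &
    \forall s \near \oo, forall j : 'I_(K s),
      c <= (s ^ 2)%:R * (M s)%:R * p (K s) j.

(* Main.v *)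
(* Let b_r be the number of servers within r hops of a server, n = s ^ 2, and
   p_j the popularity of file j. The nearest replica of j is farther than r, yet
   exists, with probability (1 - p_j)^(M b_r) - (1 - p_j)^(M n), so summing over
   r gives the expected distance to j. On the torus b_r is of order r ^ 2 until it
   reaches n, hence this sum is O(1 / sqrt (M p_j)), and it is also of that order
   from below as soon as n M p_j is bounded below and M p_j is small. Averaging
   over the requested file, the cost is of order \sum_j sqrt p_j / sqrt M.

   The uniform law is the Zipf law of parameter 0. For gamma < 2 the less popular
   half of the library already yields the full order of magnitude
   K ^ (1 - gamma / 2) / sqrt (M \sum_i i ^ (- gamma)). For gamma = 2 the
   files of rank between a constant and min (K, s) suffice, and for gamma > 2 a
   single file of large constant rank does. *)
Require Import Defs.
From HB Require Import structures.
From mathcomp Require Import all_boot all_order all_algebra.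
From mathcomp Require Import all_classical all_reals all_analysis.
From mathcomp Require Import zify ring lra.

Set Implicit Arguments.
Unset Strict Implicit.
Unset Printing Implicit Defensive.

Import Order.TTheory GRing.Theory Num.Theory.
Import numFieldNormedType.Exports.

Local Open Scope classical_set_scope.
Local Open Scope ring_scope.

(** * Balls of the torus *)

Lemma gdist_le (T : finType) (e : rel T) (u : T) (p : seq T) :
  path e u p -> (gdist e u (last u p) <= size p)%N.
Proof.
move=> pp; rewrite leqNgt; apply/negP => lt_p.
have := before_find 0%N lt_p.
have sz : (size p < #|T|)%N.
  by apply: leq_trans lt_p _; rewrite -[leqRHS](size_iota 0); apply: find_size.
rewrite nth_iota // add0n => /existsP; apply; exists (in_tuple p).
by rewrite /= pp eqxx.
Qed.

(** The bound [r < #|T|] rules out the default value [#|T|] of [gdist], so the search did find a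
    path. *)
Lemma gdist_path (T : finType) (e : rel T) (u v : T) (r : nat) :
    (gdist e u v <= r)%N -> (r < #|T|)%N ->
  exists p, [/\ path e u p, last u p = v & (size p <= r)%N].
Proof.
move=> le_r ltT; have lt_g := leq_ltn_trans le_r ltT.
have /(nth_find 0%N) : has (fun k => [exists p : k.-tuple T,
    path e u p && (last u p == v)]) (iota 0 #|T|).
  by rewrite has_find size_iota.
rewrite nth_iota // add0n => /existsP[p /andP[pp /eqP lp]].
by exists p; rewrite size_tuple.
Qed.

Lemma gdist_le_card (T : finType) (e : rel T) (u v : T) :
  (gdist e u v <= #|T|)%N.
Proof. by rewrite -[leqRHS](size_iota 0); apply: find_size. Qed.

Definition hop_ball (s : nat) (u : server s) (r : nat) : {set server s} :=
  [set v | (hops u v <= r)%N].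

Lemma val_iter_ordS (s a : nat) (i : 'I_s) :
  iter a (@ordS s) i = ((i + a) %% s)%N :> nat.
Proof.
elim: a => [|a IHa] /=; first by rewrite addn0 modn_small.
by rewrite IHa -addn1 modnDml addn1 addnS.
Qed.

Lemma iter_ordS_inj (s a b : nat) (i : 'I_s) : (a < s)%N -> (b < s)%N ->
  iter a (@ordS s) i = iter b (@ordS s) i -> a = b.
Proof.
move=> lt_a lt_b /(congr1 (@nat_of_ord s)); rewrite !val_iter_ordS => /eqP.
by rewrite eqn_modDl !modn_small // => /eqP.
Qed.

Lemma torus_path1 (s a : nat) (u : server s) :
  exists p, [/\ path (@torus_adj s) u p, size p = a
             & last u p = (iter a (@ordS s) u.1, u.2)].
Proof.
elim: a => [|a [p [pp sp lp]]]; first by exists [::]; case: u.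
exists (rcons p (iter a.+1 (@ordS s) u.1, u.2)).
rewrite rcons_path pp size_rcons sp last_rcons lp; split => //=.
by rewrite /torus_adj /cycle_adj /= !eqxx orbT.
Qed.

Lemma torus_path2 (s b : nat) (u : server s) :
  exists p, [/\ path (@torus_adj s) u p, size p = b
             & last u p = (u.1, iter b (@ordS s) u.2)].
Proof.
elim: b => [|b [p [pp sp lp]]]; first by exists [::]; case: u.
exists (rcons p (u.1, iter b.+1 (@ordS s) u.2)).
rewrite rcons_path pp size_rcons sp last_rcons lp; split => //=.
by rewrite /torus_adj /cycle_adj /= !eqxx.
Qed.

Lemma hops_shift (s a b : nat) (u : server s) :
  (hops u (iter a (@ordS s) u.1, iter b (@ordS s) u.2) <= a + b)%N.
Proof.
have [p [pp sp lp]] := torus_path1 a u.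
have [q [pq sq lq]] := torus_path2 b (last u p).
have := @gdist_le _ (@torus_adj s) u (p ++ q).
by rewrite cat_path pp pq last_cat lq lp size_cat sp sq; apply.
Qed.

Lemma card_server (s : nat) : #|server s| = (s ^ 2)%N.
Proof. by rewrite card_prod card_ord. Qed.

(** Moving forward by at most [k] steps along each axis costs at most [2 k] hops, and [k < s] keeps
    the cycles from wrapping around, so all these servers are distinct. *)
Lemma card_hop_ball_square (s r k : nat) (u : server s) :
  (k < s)%N -> (k.*2 <= r)%N -> (k.+1 ^ 2 <= #|hop_ball u r|)%N.
Proof.
move=> lt_ks le_kr.
pose f (ab : 'I_k.+1 * 'I_k.+1) : server s :=
  (iter ab.1 (@ordS s) u.1, iter ab.2 (@ordS s) u.2).
have f_inj : injective f.
  move=> [a b] [a' b'] [].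
  have lt_s (c : 'I_k.+1) : (c < s)%N by apply: leq_trans (ltn_ord c) lt_ks.
  move=> /(iter_ordS_inj (lt_s _) (lt_s _))/val_inj/= ->.
  by move=> /(iter_ordS_inj (lt_s _) (lt_s _))/val_inj/= ->.
have <- : #|{: 'I_k.+1 * 'I_k.+1}| = (k.+1 ^ 2)%N by rewrite card_prod card_ord.
rewrite -(card_imset _ f_inj); apply: subset_leq_card.
apply/fintype.subsetP => v /imsetP[[a b] _ ->]; rewrite inE.
apply: leq_trans (hops_shift a b u) _.
by have := ltn_ord a; have := ltn_ord b; lia.
Qed.

(** While [r./2 < s], the square of side [r./2 + 1] fits in the ball; beyond that, the square of
    side [s] already is the whole torus. *)
Lemma card_hop_ball_ge (s r : nat) (u : server s) :
  #|hop_ball u r| = #|server s| \/ (r.+1 ^ 2 <= 4 * #|hop_ball u r|)%N.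
Proof.
have s_gt0 : (0 < s)%N := leq_ltn_trans (leq0n _) (ltn_ord u.1).
have [lt_rs|le_sr] := ltnP r./2 s.
  right; have := @card_hop_ball_square s r r./2 u lt_rs.
  have -> : (r./2.*2 <= r)%N by lia.
  move=> /(_ isT); have : (r.+1 <= 2 * r./2.+1)%N by lia.
  by nia.
left; apply/eqP; rewrite eqn_leq max_card card_server.
have := @card_hop_ball_square s r s.-1 u; rewrite prednK //; apply; first by [].
by lia.
Qed.

(* The displacement lies in [-r, r]; it is encoded as [a - r] with [a <= 2 r],
   and [- r] is written [r * (s - 1)] modulo [s]. *)
Definition within (s r : nat) (i j : 'I_s) : Prop :=
  exists2 a, (a <= r.*2)%N & j = ((i + a + r * s.-1) %% s)%N :> nat.

Lemma within0 (s : nat) (i : 'I_s) : within 0 i i.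
Proof. by exists 0%N => //; rewrite !addn0 modn_small. Qed.

Lemma withinS (s r : nat) (i j : 'I_s) : within r i j -> within r.+1 i j.
Proof.
have s_gt0 : (0 < s)%N := leq_ltn_trans (leq0n _) (ltn_ord i).
move=> [a le_a ej]; exists a.+1; first by lia.
rewrite ej.
have -> : (i + a.+1 + r.+1 * s.-1 = (i + a + r * s.-1) + s)%N by nia.
by rewrite modnDr.
Qed.

(** Passing from [r] to [r.+1] moves the origin of the encoding by [-1] modulo [s]: a forward step
    turns [a] into [a + 2], a backward step keeps [a]. *)
Lemma within_adj (s r : nat) (i j k : 'I_s) :
  within r i j -> cycle_adj j k -> within r.+1 i k.
Proof.
have s_gt0 : (0 < s)%N := leq_ltn_trans (leq0n _) (ltn_ord i).
move=> [a le_a ej] /orP[/eqP <-|/eqP ekj].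
  exists a.+2; first by lia.
  rewrite /= ej -addn1 modnDml.
  have -> : (i + a.+2 + r.+1 * s.-1 = (i + a + r * s.-1) + 1 + s)%N by nia.
  by rewrite modnDr.
exists a; first by lia.
have -> : (i + a + r.+1 * s.-1 = (i + a + r * s.-1) + s.-1)%N by nia.
rewrite -modnDml -ej -ekj /= modnDml.
have -> : (k.+1 + s.-1 = k + s)%N by lia.
by rewrite modnDr modn_small.
Qed.

Lemma within_leq (s r t : nat) (i j : 'I_s) : (r <= t)%N ->
  within r i j -> within t i j.
Proof.
by move=> /subnK <- w; elim: (t - r)%N => [//|d IHd]; apply: withinS.
Qed.

Lemma torus_path_within (s : nat) (u : server s) (p : seq (server s)) :
    path (@torus_adj s) u p ->
  within (size p) u.1 (last u p).1 /\ within (size p) u.2 (last u p).2.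
Proof.
elim/last_ind: p => [_|p v IHp]; first by split; apply: within0.
rewrite rcons_path last_rcons size_rcons => /andP[/IHp[w1 w2]].
case/orP => /andP[].
  by move=> /eqP <- /(within_adj w2); split => //; apply: withinS.
by move=> /(within_adj w1) ? /eqP <-; split => //; apply: withinS.
Qed.

(** At most [r] hops displace each coordinate by one of [2 r + 1] values. *)
Lemma card_hop_ball_le (s r : nat) (u : server s) :
  (#|hop_ball u r| <= r.*2.+1 ^ 2)%N.
Proof.
have s_gt0 : (0 < s)%N := leq_ltn_trans (leq0n _) (ltn_ord u.1).
(* Extracting an actual path requires [r < #|server s|]; for larger [r] the bound exceeds the size
   of the torus. *)
have [leTr|lt_r] := leqP #|server s| r.
  by apply: leq_trans (max_card _) _; apply: leq_trans leTr _; nia.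
pose g (i : 'I_s) (a : nat) : 'I_s :=
  Ordinal (ltn_pmod (i + a + r * s.-1) s_gt0).
pose f (ab : 'I_(r.*2.+1) * 'I_(r.*2.+1)) : server s :=
  (g u.1 ab.1, g u.2 ab.2).
apply: (@leq_trans #|f @: [set: 'I_(r.*2.+1) * 'I_(r.*2.+1)]%SET|); last first.
  by apply: leq_trans (leq_imset_card _ _) _; rewrite cardsT card_prod card_ord.
apply: subset_leq_card; apply/fintype.subsetP => v; rewrite inE.
move=> /gdist_path/(_ lt_r)[p [/torus_path_within[w1 w2] <- le_p]].
have [a le_a ea] := within_leq le_p w1.
have [b le_b eb] := within_leq le_p w2.
apply/imsetP; exists (inord a, inord b); first by rewrite inE.
rewrite /f /= !inordK //; case: (last u p) ea eb => v1 v2 /= ea eb.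
by congr pair; apply: val_inj.
Qed.

(** * Expected distance to the nearest replica *)

Section Cost.
Variables (R : realType) (s K M : nat) (p : 'I_K -> R).
Hypothesis (s_gt0 : (0 < s)%N) (p_sum : \sum_(j < K) p j = 1).

(** The slots are independent: each of the [M * #|B|] slots of [B] avoids [j] with probability
    [1 - p j], and the other slots are unconstrained. *)
Lemma sum_placement_prob_avoid (B : {set server s}) (j : 'I_K) :
  \sum_(x : placement s K M)
     placement_prob p x * [disjoint replicas x j & B]%B%:R
  = (1 - p j) ^+ (M * #|B|).
Proof.
(* The event is a product of one indicator per slot, so it can be absorbed into the weight of each
   cache. *)
pose G (v : server s) (f : {ffun 'I_M -> 'I_K}) : R :=
  \prod_(m < M) (p (f m) * (~~ ((v \in B) && (f m == j)))%:R).
transitivity (\sum_(x : placement s K M) \prod_v G v (x v)).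
  apply: eq_bigr => x _; rewrite /placement_prob.
  transitivity ((\prod_(v : server s) \prod_(m < M) p (x v m)) *
     (\prod_(v : server s) \prod_(m < M)
        ((~~ ((v \in B) && (x v m == j)))%:R : R))).
    congr (_ * _); have [dis|ndis] := boolP [disjoint replicas x j & B]%B.
      rewrite big1 // => v _; rewrite big1 // => m _.
      have [vB|//] := boolP (v \in B); have [xj|//] := boolP (x v m == j).
      have : v \in replicas x j by rewrite inE; apply/existsP; exists m.
      by move=> /(disjointFr dis); rewrite vB.
    move: ndis; rewrite -setI_eq0 => /set0Pn[v]; rewrite !inE.
    move=> /andP[/existsP[m xj] vB].
    by rewrite (bigD1 v) //= (bigD1 m) //= vB xj /= !mul0r.
  rewrite -big_split /=; apply: eq_bigr => v _.
  by rewrite -big_split.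
(* Distributivity turns the sum over placements into a product over servers; the same is done below
   for the slots of one server. *)
rewrite -bigA_distr_bigA /= (bigID (mem B)) /=.
have inB v : v \in B -> \sum_f G v f = (1 - p j) ^+ M.
  move=> vB; rewrite /G.
  rewrite -(bigA_distr_bigA
    (fun (m : 'I_M) i => p i * (~~ ((v \in B) && (i == j)))%:R)) /=.
  rewrite prodr_const card_ord vB /=; congr (_ ^+ _).
  rewrite -[X in X - p j]p_sum [in RHS](bigD1 j) //=.
  rewrite [in LHS](bigD1 j) //= eqxx mulr0 add0r.
  rewrite [p j + _]addrC addrK; apply: eq_bigr => i ij.
  by rewrite (negbTE ij) mulr1.
have notinB v : v \notin B -> \sum_f G v f = 1.
  move=> vB; rewrite /G.
  rewrite -(bigA_distr_bigA
    (fun (m : 'I_M) i => p i * (~~ ((v \in B) && (i == j)))%:R)) /=.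
  rewrite (negbTE vB) /= big1 // => m _.
  by rewrite -[RHS]p_sum; apply: eq_bigr => i _; rewrite mulr1.
rewrite (eq_bigr (fun=> (1 - p j) ^+ M)) // prodr_const -exprM.
by rewrite [X in _ * X]big1 ?mulr1 //.
Qed.

Lemma sum_placement_prob_none (j : 'I_K) :
  \sum_(x : placement s K M)
     placement_prob p x * (replicas x j == finset.set0)%:R
  = (1 - p j) ^+ (M * s ^ 2).
Proof.
rewrite -card_server -cardsT -sum_placement_prob_avoid.
by apply: eq_bigr => x _; rewrite -setI_eq0 finset.setIT.
Qed.

Lemma sum_placement_prob : (0 < K)%N ->
  \sum_(x : placement s K M) placement_prob p x = 1.
Proof.
move=> K_gt0; have := sum_placement_prob_avoid finset.set0 (Ordinal K_gt0).
rewrite cards0 muln0 expr0 => <-; apply: eq_bigr => x _.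
by rewrite -setI_eq0 finset.setI0 eqxx mulr1.
Qed.

Lemma nearest_replicas_ex (x : placement s K M) (u : server s) (j : 'I_K) :
  replicas x j != finset.set0 -> exists v, v \in nearest_replicas x u j.
Proof.
move=> /set0Pn[w0 w0P].
case: (arg_minnP (fun v => hops u v) w0P) => v vP vmin.
exists v; rewrite inE; apply/andP; split; first exact: vP.
by apply/forall_inP => w /vmin.
Qed.

(** Tie-breaking does not matter for a quantity that is constant on the nearest replicas; the
    indicator is the total mass of [assign_prob]. *)
Lemma sum_assign_prob (x : placement s K M) (u : server s) (j : 'I_K)
    (f : server s -> R) (c : R) :
    {in nearest_replicas x u j, forall v, f v = c} ->
  \sum_v assign_prob R x u j v * f v = (replicas x j != finset.set0)%:R * c.
Proof.
move=> fc; set N := nearest_replicas x u j in fc *.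
transitivity (\sum_(v in N) c / #|N|%:R).
  rewrite [RHS]big_mkcond /=; apply: eq_bigr => v _.
  rewrite /assign_prob -/N.
  have [vN|vN] := boolP (v \in N); last by rewrite !mul0r.
  by rewrite fc // mul1r mulrC.
rewrite sumr_const -[LHS]mulr_natr.
have [r0|rN0] := eqVneq (replicas x j) finset.set0.
  have -> : #|N| = 0%N.
    apply/eqP; rewrite cards_eq0 -finset.subset0 -r0.
    by apply/fintype.subsetP => v; rewrite inE => /andP[].
  by rewrite mulr0 mul0r.
have [v vN] := nearest_replicas_ex u rN0.
have : #|N|%:R != 0 :> R by rewrite pnatr_eq0 -lt0n; apply/card_gt0P; exists v.
by move=> N0; rewrite mul1r divfK.
Qed.

(** Layer-cake formula: the balls that miss every replica are exactly those of radius
    [r < hops u v], and [hops u v] never exceeds [s ^ 2]. *)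
Lemma nearest_hops_sum (x : placement s K M) (u v : server s) (j : 'I_K) :
    v \in nearest_replicas x u j ->
  (hops u v)%:R =
  \sum_(r < s ^ 2) [disjoint replicas x j & hop_ball u r]%B%:R :> R.
Proof.
rewrite inE => /andP[vr /forall_inP vmin].
have le_n : (hops u v <= s ^ 2)%N by rewrite -card_server; apply: gdist_le_card.
rewrite -natr_sum; congr (_%:R).
rewrite -(big_mkord xpredT
  (fun r => [disjoint replicas x j & hop_ball u r]%B : nat)) /=.
rewrite (big_cat_nat (leq0n _) le_n) //= [X in (_ + X)%N]big_nat_cond.
rewrite [X in (_ + X)%N]big1 ?addn0; last first.
  move=> r /andP[/andP[le_r _] _]; apply/eqP; rewrite eqb0 -setI_eq0.
  by apply/set0Pn; exists v; rewrite finset.in_setI vr inE.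
rewrite big_nat_cond (eq_bigr (fun=> 1%N)).
  by rewrite -big_nat_cond sum_nat_const_nat muln1 subn0.
move=> r /andP[/andP[_ lt_r] _]; apply/eqP; rewrite eqb1 -setI_eq0.
apply/set0Pn => -[w]; rewrite finset.in_setI => /andP[/vmin le_w].
by rewrite inE leqNgt (leq_trans lt_r).
Qed.

(** The subtracted indicator corrects for an uncached file: every ball then misses it, while no hop
    is counted. *)
Lemma sum_assign_hops (x : placement s K M) (u : server s) (j : 'I_K) :
  \sum_v assign_prob R x u j v * (hops u v)%:R =
  \sum_(r < s ^ 2) ([disjoint replicas x j & hop_ball u r]%B%:R
                    - (replicas x j == finset.set0)%:R).
Proof.
rewrite (sum_assign_prob (fun v => @nearest_hops_sum x u v j)) mulr_sumr.
apply: eq_bigr => r _; have [->|_] := eqVneq (replicas x j) finset.set0.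
  by rewrite -setI_eq0 finset.set0I eqxx subrr mul0r.
by rewrite mul1r subr0.
Qed.

(** This is the mean over placements of the distance from [u] to the nearest replica of [j], taken
    as 0 if there is none. Keeping [u] as an argument avoids an appeal to the symmetry of the
    torus. *)
Definition mean_hops (u : server s) (j : 'I_K) : R :=
  \sum_(r < s ^ 2)
     ((1 - p j) ^+ (M * #|hop_ball u r|) - (1 - p j) ^+ (M * s ^ 2)).

Lemma served_probE :
  served_prob s M p = \sum_(j < K) p j * (1 - (1 - p j) ^+ (M * s ^ 2)).
Proof.
have n0 : (s ^ 2)%:R != 0 :> R by rewrite pnatr_eq0 -lt0n expn_gt0 s_gt0.
rewrite /served_prob.
transitivity (\sum_(x : placement s K M) \sum_(j < K)
    placement_prob p x * p j * (replicas x j != finset.set0)%:R).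
  apply: eq_bigr => x _; rewrite exchange_big /=; apply: eq_bigr => j _.
  transitivity (\sum_(u : server s) (s ^ 2)%:R^-1 *
     (placement_prob p x * p j * (replicas x j != finset.set0)%:R)).
    apply: eq_bigr => u _; rewrite /outcome_prob -mulr_sumr.
    have := @sum_assign_prob x u j (fun=> 1) 1 (fun _ _ => erefl).
    under eq_bigr do rewrite mulr1.
    by move=> ->; rewrite card_server; ring.
  rewrite sumr_const card_server -[LHS]mulr_natl mulrA divff // mul1r //.
rewrite exchange_big /=; apply: eq_bigr => j _.
have K_gt0 : (0 < K)%N by apply: leq_ltn_trans (ltn_ord j).
rewrite -sum_placement_prob_none -[X in X - _](sum_placement_prob K_gt0).
rewrite -sumrB mulr_sumr.
by apply: eq_bigr => x _; case: eqVneq => _ /=; ring.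
Qed.

Lemma comm_costE :
  comm_cost s M p =
  ((s ^ 2)%:R^-1 * \sum_(u : server s) \sum_(j < K) p j * mean_hops u j)
  / served_prob s M p.
Proof.
rewrite /comm_cost; congr (_ / _).
rewrite exchange_big mulr_sumr /=; apply: eq_bigr => u _.
rewrite exchange_big mulr_sumr /=; apply: eq_bigr => j _.
transitivity (\sum_(x : placement s K M) \sum_(r < s ^ 2)
  (s ^ 2)%:R^-1 * (p j *
   (placement_prob p x * [disjoint replicas x j & hop_ball u r]%B%:R
    - placement_prob p x * (replicas x j == finset.set0)%:R))).
  apply: eq_bigr => x _; rewrite /outcome_prob.
  under eq_bigr do rewrite -mulrA.
  rewrite -mulr_sumr sum_assign_hops mulr_sumr card_server.
  by apply: eq_bigr => r _; ring.
rewrite exchange_big /mean_hops !mulr_sumr /=; apply: eq_bigr => r _.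
rewrite -!mulr_sumr sumrB sum_placement_prob_avoid sum_placement_prob_none.
by [].
Qed.
End Cost.

(** * The cost of a single file *)

Lemma Bernoulli_1B (R : realType) (x : R) (n : nat) :
  0 <= x <= 1 -> 1 - n%:R * x <= (1 - x) ^+ n.
Proof.
move=> /andP[x0 x1]; elim: n => [|n IHn]; first by rewrite expr0 mul0r subr0.
have n0 : 0 <= n%:R :> R by [].
rewrite exprS -natr1; apply: le_trans (_ : (1 - x) * (1 - n%:R * x) <= _).
  by nra.
by apply: ler_wpM2l => //; lra.
Qed.

(** A rational substitute for the bound by [expR (- n x)]. The induction step is
    [(1 - x) (1 + (n + 1) x) <= 1 + n x]. *)
Lemma expr_1B_le (R : realType) (x : R) (n : nat) :
  0 <= x <= 1 -> (1 - x) ^+ n <= (1 + n%:R * x)^-1.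
Proof.
move=> /andP[x0 x1]; elim: n => [|n IHn].
  by rewrite expr0 mul0r addr0 invr1.
have n0 : 0 <= n%:R :> R by [].
rewrite exprS -natr1; apply: le_trans (_ : (1 - x) * (1 + n%:R * x)^-1 <= _).
  by apply: ler_wpM2l => //; lra.
rewrite ler_pdivrMr; last by nra.
rewrite mulrC ler_pdivlMr; last by nra.
by nra.
Qed.

(** A discrete form of the arctangent integral. The sum is compared with the telescoping quantity
    [2 / t * (1 - (1 + t N)^-1)]; the increments compare since [(1 + y) ^+ 2 <= 2 (1 + y ^+ 2)]. *)
Lemma sum_inv_1Dsqr_le (R : realType) (t : R) (N : nat) : 0 < t ->
  \sum_(r < N) (1 + (t * r.+1%:R) ^+ 2)^-1 <= 2 / t.
Proof.
move=> t0.
suff /le_trans: \sum_(r < N) (1 + (t * r.+1%:R) ^+ 2)^-1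
    <= 2 / t * (1 - (1 + t * N%:R)^-1).
  have t2 : 0 <= 2 / t by rewrite divr_ge0 // ltW.
  apply; rewrite ler_piMr // gerBl invr_ge0.
  by rewrite addr_ge0 // mulr_ge0 // ltW.
elim: N => [|N IHN]; first by rewrite big_ord0 mulr0 addr0 invr1 subrr mulr0.
rewrite big_ord_recr /=; have N0 : 0 <= N%:R :> R by [].
rewrite -natr1; set n := N%:R in IHN N0 *.
apply: le_trans (lerD IHN (lexx _)) _; rewrite -lerBrDl -mulrBr.
have a0 : 0 < 1 + t * n by nra.
have b0 : 0 < 1 + t * (n + 1) by nra.
have c0 : 0 < 1 + (t * (n + 1)) ^+ 2 by rewrite ltr_wpDr // sqr_ge0.
have -> : 2 / t * (1 - (1 + t * (n + 1))^-1 - (1 - (1 + t * n)^-1))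
   = 2 / ((1 + t * n) * (1 + t * (n + 1))).
  by field; rewrite !gt_eqF.
rewrite ler_pdivlMr ?mulr_gt0 // mulrC ler_pdivrMr //.
have : 0 <= (t * (n + 1) - 1) ^+ 2 by rewrite sqr_ge0.
by nra.
Qed.

Section FileBounds.
Variables (R : realType) (s K M : nat) (p : 'I_K -> R).
Variables (u : server s) (j : 'I_K).
Hypothesis (M_gt0 : (0 < M)%N) (p_gt0 : 0 < p j) (p_le1 : p j <= 1).

Let a : R := M%:R * p j.

Let a_gt0 : 0 < a.
Proof. by rewrite mulr_gt0 ?ltr0n. Qed.

Let pI : 0 <= p j <= 1.
Proof. by rewrite ltW. Qed.

Let q01 : 0 <= 1 - p j <= 1.
Proof. by rewrite subr_ge0 p_le1 gerBl ltW. Qed.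

Lemma mean_hops_term_ge0 (r : nat) :
  0 <= (1 - p j) ^+ (M * #|hop_ball u r|) - (1 - p j) ^+ (M * s ^ 2).
Proof.
have /andP[q0 q1] := q01.
rewrite subr_ge0 ler_wiXn2l // leq_mul2l -card_server max_card orbT //.
Qed.

Lemma mean_hops_ge0 : 0 <= mean_hops M p u j.
Proof. by apply: sumr_ge0 => r _; apply: mean_hops_term_ge0. Qed.

(** A ball that fills the torus gives a zero term. Otherwise it has at least [(r + 1) ^ 2 / 4]
    servers, and the term is at most [(1 + (t (r + 1)) ^+ 2)^-1] with [t = Num.sqrt a / 2]. *)
Lemma mean_hops_le : mean_hops M p u j <= 4 / Num.sqrt (M%:R * p j).
Proof.
rewrite -/a; have sa0 : 0 < Num.sqrt a by rewrite sqrtr_gt0.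
have -> : 4 / Num.sqrt a = 2 / (Num.sqrt a / 2) by field; rewrite gt_eqF.
apply: le_trans (sum_inv_1Dsqr_le (s ^ 2) _); last by rewrite divr_gt0.
apply: ler_sum => r _; case: (card_hop_ball_ge r u) => [->|ge_r].
  by rewrite card_server subrr invr_ge0 addr_ge0 // sqr_ge0.
apply: le_trans (_ : (1 - p j) ^+ (M * #|hop_ball u r|) <= _).
  by rewrite gerBl exprn_ge0 //; case/andP: q01.
apply: le_trans (expr_1B_le _ pI) _.
rewrite lef_pV2 ?posrE; last 2 first.
- by rewrite ltr_wpDr // mulr_ge0 // ltW.
- by rewrite ltr_wpDr // sqr_ge0.
rewrite lerD2l !exprMn sqr_sqrtr; last exact: ltW.
have -> : (M * #|hop_ball u r|)%:R * p j = a * #|hop_ball u r|%:R.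
  by rewrite natrM mulrAC.
rewrite -mulrA ler_pM2l // mulrC exprVn -natrX.
by rewrite ler_pdivrMr ?exprn_gt0 // -!natrX -natrM ler_nat; lia.
Qed.

(** Only radii below about [sqrt (c / (8 a))] are kept. Such a ball holds at most [c / 2] copies of
    [j] on average and leaves at least [c / 2] outside, so missing [j] inside while having it
    outside has probability of order [c]. *)
Lemma mean_hops_ge (c : R) : 0 < c -> c <= 1 ->
    c <= (s ^ 2)%:R * a -> a <= c / 8 ->
  c / 12 * Num.sqrt (c / 8) / Num.sqrt a <= mean_hops M p u j.
Proof.
move=> c0 c1 ca ac.
pose L := Num.sqrt (c / 8 / a).
have ca0 : 0 <= c / 8 / a by rewrite divr_ge0 // ltW // divr_gt0.
have L1 : 1 <= L by rewrite -sqrtr1 ler_sqrt // ler_pdivlMr // mul1r.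
have L0 : 0 <= L by rewrite sqrtr_ge0.
have L2 : L ^+ 2 * a = c / 8 by rewrite sqr_sqrtr // divfK // gt_eqF.
(* The integer part of [L] is at least [L / 2] because [1 <= L], which is where [a <= c / 8]
   enters. *)
have [rho [rhoL Lrho rho1]] :
    exists rho : nat, [/\ rho%:R <= L, L < rho.+1%:R & 1 <= rho%:R :> R].
  exists (Num.truncn L); have /andP[-> ->] := truncn_itv L0.
  by rewrite ler1n truncn_gt0.
have Lrho2 : L / 2 <= rho%:R by rewrite -natr1 in Lrho; lra.
have rho2 : rho%:R ^+ 2 <= L ^+ 2 by rewrite lerXn2r ?nnegrE.
have n4 : (4 * rho ^ 2)%:R * a <= c / 2.
  rewrite natrM natrX; have := ler_wpM2r (ltW a_gt0) rho2.
  by rewrite L2; lra.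
have n4n : (4 * rho ^ 2 <= s ^ 2)%N.
  rewrite -(ler_nat R) -(ler_pM2r a_gt0); lra.
have term (r : 'I_(s ^ 2)) : (r < rho)%N ->
    c / 6 <= (1 - p j) ^+ (M * #|hop_ball u r|) - (1 - p j) ^+ (M * s ^ 2).
  move=> lt_r; set b := #|hop_ball u r|.
  have le_b : (b <= 4 * rho ^ 2)%N.
    apply: leq_trans (card_hop_ball_le r u) _.
    have -> : (4 * rho ^ 2 = rho.*2 ^ 2)%N by rewrite -muln2 expnMn mulnC.
    by rewrite leq_exp2r // ltn_double.
  have le_bn : (b <= s ^ 2)%N by apply: leq_trans n4n.
  have ba : b%:R * a <= c / 2.
    by apply: le_trans n4; rewrite ler_pM2r // ler_nat.
  (* Splitting the slots factors the term as the probability of missing the ball times that of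
     hitting its complement. *)
  have -> : (M * s ^ 2 = M * b + M * (s ^ 2 - b))%N by rewrite -mulnDr subnKC.
  rewrite exprD -[X in X - _]mulr1 -mulrBr.
  have h1 : 1 / 2 <= (1 - p j) ^+ (M * b).
    apply: le_trans (Bernoulli_1B _ pI).
    by rewrite natrM mulrAC -/a; lra.
  have h2 : c / 3 <= 1 - (1 - p j) ^+ (M * (s ^ 2 - b)).
    rewrite lerBrDr -lerBrDl; apply: le_trans (expr_1B_le _ pI) _.
    rewrite natrM mulrAC -/a natrB // mulrBr [a * (s ^ 2)%:R]mulrC [a * b%:R]mulrC.
    set y := _ - _; have y0 : c / 2 <= y by rewrite /y; lra.
    have y1 : 0 < 1 + y by lra.
    rewrite -div1r ler_pdivrMr //.
    (* This product is [1 + c (1 - c) / 6], hence at least 1 for [c <= 1]. *)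
    apply: le_trans (_ : (1 - c / 3) * (1 + c / 2) <= _); last first.
      by apply: ler_wpM2l; lra.
    have : 0 <= c * (1 - c) by rewrite mulr_ge0 ?subr_ge0 // ltW.
    by lra.
  have -> : c / 6 = 1 / 2 * (c / 3) by field.
  by apply: ler_pM => //; lra.
apply: le_trans (_ : \sum_(r < s ^ 2 | (r < rho)%N) c / 6 <= _).
  have le_rn : (rho <= s ^ 2)%N.
    apply: leq_trans n4n; apply: leq_trans (leq_pmull _ _) => //.
    by rewrite -mulnn leq_pmulr // -(ltr0n R) (lt_le_trans ltr01).
  rewrite -(big_ord_widen _ (fun=> c / 6) le_rn) sumr_const card_ord.
  have -> : c / 12 * Num.sqrt (c / 8) / Num.sqrt a = c / 6 * (L / 2).
    have c8 : 0 <= c / 8 by rewrite ltW // divr_gt0.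
    rewrite /L (sqrtrM _ c8) sqrtrV; last exact: ltW.
    by field; rewrite gt_eqF // sqrtr_gt0.
  rewrite -[leRHS]mulr_natr ler_pM2l //; last by rewrite divr_gt0.
rewrite /mean_hops [leRHS](bigID (fun r : 'I_(s ^ 2) => (r < rho)%N)) /=.
rewrite -[leLHS]addr0 lerD //; first exact: ler_sum.
by apply: sumr_ge0 => r _; apply: mean_hops_term_ge0.
Qed.

End FileBounds.

(** * Cost bounds and power sums *)

Section CostBounds.
Variables (R : realType) (s K M : nat) (p : 'I_K -> R).
Hypothesis (s_gt0 : (0 < s)%N) (M_gt0 : (0 < M)%N).
Hypothesis (p_gt0 : forall j, 0 < p j) (p_sum : \sum_(j < K) p j = 1).

Let p_le1 (j : 'I_K) : p j <= 1.
Proof.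
by rewrite -p_sum (bigD1 j) //= lerDl sumr_ge0 // => i _; apply: ltW.
Qed.

Let p01 (j : 'I_K) : 0 <= p j <= 1.
Proof. by rewrite p_le1 ltW. Qed.

Let served_term_ge0 (j : 'I_K) : 0 <= p j * (1 - (1 - p j) ^+ (M * s ^ 2)).
Proof.
have /andP[p0 p1] := p01 j; apply: mulr_ge0 => //.
by rewrite subr_ge0 exprn_ile1 ?subr_ge0 ?gerBl.
Qed.

Lemma served_prob_le1 : served_prob s M p <= 1.
Proof.
rewrite served_probE // -[leRHS]p_sum; apply: ler_sum => j _.
have /andP[p0 p1] := p01 j; apply: ler_piMr => //.
by rewrite gerBl exprn_ge0 ?subr_ge0.
Qed.

(** Each file has at least [c] expected copies, so it is absent with probability at most
    [(1 + c)^-1]. *)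
Lemma served_prob_ge (c : R) : 0 < c ->
    (forall j, c <= (s ^ 2)%:R * M%:R * p j) ->
  c / (1 + c) <= served_prob s M p.
Proof.
move=> c0 cp; rewrite served_probE //.
have -> : c / (1 + c) = \sum_(j < K) p j * (c / (1 + c)).
  by rewrite -mulr_suml p_sum mul1r.
apply: ler_sum => j _; rewrite ler_pM2l //.
rewrite lerBrDr -lerBrDl; apply: le_trans (expr_1B_le _ (p01 j)) _.
have -> : 1 - c / (1 + c) = (1 + c)^-1 by field; rewrite gt_eqF // addr_gt0.
have cM : c <= (M * s ^ 2)%:R * p j by rewrite mulnC natrM.
by rewrite lef_pV2 ?posrE ?lerD2l // addr_gt0 // (lt_le_trans c0).
Qed.

(** A request for [j] has probability [p j], and a single slot already holds [j] with probability
    [p j]. This bounds the conditioning without any replication assumption. *)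
Lemma served_prob_ge_sqr (j : 'I_K) : p j ^+ 2 <= served_prob s M p.
Proof.
rewrite served_probE // (bigD1 j) //= expr2.
apply: le_trans (_ : p j * (1 - (1 - p j) ^+ (M * s ^ 2)) <= _); last first.
  by rewrite lerDl sumr_ge0.
rewrite ler_pM2l // lerBrDr -lerBrDl -[leRHS]expr1.
by apply: ler_wiXn2l;
  rewrite ?subr_ge0 ?gerBl ?muln_gt0 ?M_gt0 ?expn_gt0 ?s_gt0 // ltW.
Qed.

Let div_sqrt (j : 'I_K) :
  p j / Num.sqrt (M%:R * p j) = Num.sqrt (p j) / Num.sqrt M%:R.
Proof.
have M0 : 0 < Num.sqrt M%:R :> R by rewrite sqrtr_gt0 ltr0n.
have P0 : 0 < Num.sqrt (p j) by rewrite sqrtr_gt0.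
rewrite sqrtrM // -[X in X / _](sqr_sqrtr (ltW (p_gt0 j))).
by field; rewrite !gt_eqF.
Qed.

Let mean_server (f : server s -> R) (c : R) : (forall u, f u <= c) ->
  (s ^ 2)%:R^-1 * \sum_(u : server s) f u <= c.
Proof.
move=> fc; have n0 : 0 < (s ^ 2)%:R :> R by rewrite ltr0n expn_gt0 s_gt0.
rewrite ler_pdivrMl //; apply: le_trans (ler_sum _ (fun u _ => fc u)) _.
by rewrite sumr_const card_server mulr_natl.
Qed.

Lemma comm_cost_le (d : R) : 0 < d -> d <= served_prob s M p ->
  comm_cost s M p <= 4 / d * ((\sum_(j < K) Num.sqrt (p j)) / Num.sqrt M%:R).
Proof.
move=> d0 dsp; rewrite comm_costE //.
have sp0 := lt_le_trans d0 dsp.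
set X := _ / Num.sqrt M%:R.
have X0 : 0 <= X by rewrite divr_ge0 ?sqrtr_ge0 ?sumr_ge0.
rewrite ler_pdivrMr //; apply: le_trans (_ : 4 * X <= _); last first.
  have -> : 4 / d * X * served_prob s M p = 4 * X * (served_prob s M p / d).
    by field; rewrite gt_eqF.
  by apply: ler_peMr; [exact: mulr_ge0|rewrite ler_pdivlMr // mul1r].
apply: mean_server => u; rewrite /X mulr_suml mulr_sumr; apply: ler_sum => j _.
rewrite -div_sqrt mulrCA ler_pM2l //.
exact: mean_hops_le.
Qed.

(** Files outside [J] contribute nonnegative terms, and dividing by a probability can only increase
    the cost. *)
Lemma comm_cost_ge (c : R) (J : pred 'I_K) : 0 < c -> c <= 1 ->
    (forall j, J j -> c <= (s ^ 2)%:R * (M%:R * p j)) ->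
    (forall j, J j -> M%:R * p j <= c / 8) ->
  c / 12 * Num.sqrt (c / 8)
    * ((\sum_(j < K | J j) Num.sqrt (p j)) / Num.sqrt M%:R)
  <= comm_cost s M p.
Proof.
move=> c0 c1 Jc J8; rewrite comm_costE //.
have K_gt0 : (0 < K)%N.
  case: (posnP K) => // K0; have /eqP := p_sum; rewrite big1.
    by rewrite eq_sym oner_eq0.
  by move=> [i iK] _; exfalso; move: (iK); rewrite K0.
have sp0 : 0 < served_prob s M p.
  by apply: lt_le_trans (served_prob_ge_sqr (Ordinal K_gt0)); rewrite exprn_gt0.
set k := c / 12 * _.
have k0 : 0 <= k by rewrite mulr_ge0 ?sqrtr_ge0 // divr_ge0 // ltW.
rewrite ler_pdivlMr //; set X := _ / Num.sqrt M%:R.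
have X0 : 0 <= X by rewrite divr_ge0 ?sqrtr_ge0 ?sumr_ge0.
apply: le_trans (_ : k * X <= _).
  by apply: ler_piMr; [exact: mulr_ge0|exact: served_prob_le1].
(* The lower bound on the mean over servers is the upper bound for the opposite function. *)
rewrite -lerN2 -mulrN -sumrN; apply: mean_server => u; rewrite lerN2.
rewrite [leRHS](bigID J) /= -[leLHS]addr0; apply: lerD; last first.
  by apply: sumr_ge0 => j _; rewrite mulr_ge0 ?mean_hops_ge0 // ltW.
rewrite /X mulr_suml mulr_sumr; apply: ler_sum => j Jj.
rewrite -div_sqrt mulrCA ler_pM2l //.
by apply: mean_hops_ge => //; [exact: Jc|exact: J8].
Qed.

End CostBounds.

(** * Growth of the partial sums of [i ^ (- a)] *)

Definition power_sum (R : realType) (a : R) (N : nat) : R :=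
  \sum_(i < N) i.+1%:R `^ (- a).

Section PowerSums.
Variable R : realType.
Implicit Types (a b : R) (i N : nat).

(** Both sides are compared with [expR (- b / i)]. The lemma bounds the relative increments of
    powers in the inductions below. *)
Lemma powR_1BV_le b i : 0 < b -> (0 < i)%N ->
  (1 - i%:R^-1) `^ b <= (1 + b / i%:R)^-1.
Proof.
move=> b0 i0; have i1 : 1 <= i%:R :> R by rewrite ler1n.
have bi0 : 0 < b / i%:R by rewrite divr_gt0 // ltr0n.
apply: le_trans (_ : expR (- i%:R^-1) `^ b <= _).
  apply: ge0_ler_powR; rewrite ?nnegrE ?expR_ge0 //; first exact: ltW.
    by rewrite subr_ge0 invf_le1 // ltr0n.
  exact: expR_ge1Dx.
rewrite -expRM mulNr expRN lef_pV2 ?posrE ?expR_gt0 //; last by rewrite addr_gt0.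
by rewrite mulrC; apply: expR_ge1Dx.
Qed.

Let powR_pred i b : (0 < i)%N ->
  i%:R `^ b = i.+1%:R `^ b * (1 - i.+1%:R^-1) `^ b.
Proof.
move=> i0; rewrite -powRM //; last by rewrite subr_ge0 invf_le1 ?ler1n ?ltr0n.
by congr (_ `^ _); rewrite mulrBr mulfV // mulr1 -natr1 addrK.
Qed.

Lemma power_sum_ge1 a N : (0 < N)%N -> 1 <= power_sum a N.
Proof.
case: N => // N _; rewrite /power_sum big_ord_recl /= powR1 lerDl.
by apply: sumr_ge0 => i _; apply: powR_ge0.
Qed.

Lemma power_sum_gt0 a N : (0 < N)%N -> 0 < power_sum a N.
Proof. by move=> N0; apply: lt_le_trans (power_sum_ge1 a N0). Qed.

Lemma power_sum_ge a N : 0 <= a -> (0 < N)%N ->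
  N%:R `^ (1 - a) <= power_sum a N.
Proof.
move=> a0 N0; have NR0 : 0 < N%:R :> R by rewrite ltr0n.
rewrite powRD; last by rewrite (gt_eqF NR0) implybT.
rewrite powRr1 //.
have -> : N%:R * N%:R `^ (- a) = \sum_(i < N) N%:R `^ (- a).
  by rewrite sumr_const card_ord mulr_natl.
apply: ler_sum => i _.
rewrite !powRN lef_pV2 ?posrE ?powR_gt0 ?ltr0n //.
by apply: ge0_ler_powR; rewrite ?nnegrE ?ler0n // ler_nat ltn_ord.
Qed.

(** Induction on [N]: with [b = 1 - a] and [x = N + 1], the right-hand side grows by at least
    [x ^ b * 2 / (x + b)], which dominates the new term [x ^ b / x] because [b <= 1 <= x]. *)
Lemma power_sum_le a N : 0 <= a -> a < 1 ->
  power_sum a N <= 2 / (1 - a) * N%:R `^ (1 - a).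
Proof.
move=> a0 a1; set b := 1 - a; have b0 : 0 < b by rewrite subr_gt0.
have b1 : b <= 1 by rewrite gerBl.
elim: N => [|N IHN].
  by rewrite /power_sum big_ord0 powR0 ?mulr0 // gt_eqF.
rewrite /power_sum big_ord_recr /= -/(power_sum a N).
apply: le_trans (lerD IHN (lexx _)) _; rewrite -lerBrDl -mulrBr.
have N1 : 0 < N.+1%:R :> R by rewrite ltr0n.
have -> : N.+1%:R `^ (- a) = N.+1%:R `^ b / N.+1%:R.
  rewrite -[X in _ / X]powRr1 // -powRB; last by rewrite (gt_eqF N1) implybT.
  by congr (_ `^ _); rewrite /b; ring.
have le_N : N%:R `^ b <= N.+1%:R `^ b * (1 + b / N.+1%:R)^-1.
  have [->|N0] := posnP N.
    by rewrite powR0 ?gt_eqF // mulr_ge0 ?powR_ge0 // invr_ge0 addr_ge0 // divr_ge0 // ltW.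
  by rewrite powR_pred // ler_wpM2l ?powR_ge0 // powR_1BV_le.
apply: le_trans (_ : 2 / b * (N.+1%:R `^ b * (1 - (1 + b / N.+1%:R)^-1)) <= _); last first.
  by rewrite ler_pM2l ?divr_gt0 // mulrBr mulr1 lerB.
rewrite mulrCA ler_wpM2l ?powR_ge0 //.
set x := N.+1%:R in N1 *; have x1 : 1 <= x by rewrite ler1n.
have xb : 0 < x + b by rewrite addr_gt0.
clearbody x b.
have -> : 2 / b * (1 - (1 + b / x)^-1) = 2 / (x + b).
  by field; rewrite !gt_eqF.
by rewrite -div1r ler_pdivrMr // mulrAC ler_pdivlMr //; lra.
Qed.

(** The induction needs the sharper bound [1 + b^-1 * (1 - N ^ (- b))] with [b = a - 1], obtained by
    comparison with the integral of [x ^ (- a)]. *)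
Lemma power_sum_bounded a N : 1 < a -> power_sum a N <= 1 + (a - 1)^-1.
Proof.
move=> a1; set b := a - 1; have b0 : 0 < b by rewrite subr_gt0.
case: N => [|N]; first by rewrite /power_sum big_ord0 addr_ge0 // invr_ge0 ltW.
suff /le_trans: power_sum a N.+1 <= 1 + b^-1 * (1 - N.+1%:R `^ (- b)).
  by apply; rewrite lerD2l ler_piMr ?invr_ge0 ?gerBl ?powR_ge0 // ltW.
elim: N => [|N IHN].
  by rewrite /power_sum big_ord1 powR1 subrr mulr0 addr0.
rewrite /power_sum big_ord_recr /= -/(power_sum a N.+1).
apply: le_trans (lerD IHN (lexx _)) _; rewrite -addrA lerD2l -lerBrDl -mulrBr.
set x := N.+2%:R.
have x0 : 0 < x :> R by rewrite ltr0n.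
have x1 : 1 < x :> R by rewrite ltr1n.
have -> : x `^ (- a) = x `^ (- b) / x.
  rewrite -[X in _ / X]powRr1 ?ltW // -powRB; last by rewrite (gt_eqF x0) implybT.
  by congr (_ `^ _); rewrite /b; ring.
have -> : 1 - x `^ (- b) - (1 - N.+1%:R `^ (- b))
    = N.+1%:R `^ (- b) - x `^ (- b) by ring.
rewrite (powR_pred (- b) (ltn0Sn N)) -/x.
have ge_b : 1 + b / x <= (1 - x^-1) `^ (- b).
  rewrite powRN -[leLHS]invrK lef_pV2 ?posrE.
  - exact: powR_1BV_le.
  - by rewrite invr_gt0 addr_gt0 // divr_gt0.
  - by rewrite powR_gt0 // subr_gt0 invf_lt1.
rewrite ler_pdivlMl // mulrCA -[X in _ <= _ - X]mulr1 -mulrBr.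
by rewrite ler_wpM2l ?powR_ge0 // lerBrDl.
Qed.

Lemma power_sum1_ge_ln N : (0 < N)%N -> ln N%:R <= power_sum (1 : R) N.
Proof.
(* With [N.+1] the induction can start from the empty sum, and each step is [ln (1 + y) <= y]. *)
move=> N0; apply: le_trans (_ : ln N.+1%:R <= _).
  by rewrite ler_ln ?posrE ?ltr0n // ler_nat.
elim: N {N0} => [|N IHN]; first by rewrite /power_sum big_ord0 ln1.
rewrite /power_sum big_ord_recr /= -/(power_sum 1 N.+1).
have N1 : 0 < N.+1%:R :> R by rewrite ltr0n.
apply: le_trans (lerD IHN (lexx _)); rewrite powR_inv1 //.
have -> : N.+2%:R = N.+1%:R * (1 + N.+1%:R^-1) :> R.
  by rewrite mulrDr mulr1 mulfV ?gt_eqF // natr1.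
have V0 : 0 < 1 + N.+1%:R^-1 :> R by rewrite addr_gt0 // invr_gt0.
rewrite lnM ?posrE // lerD2l; apply: le_ln1Dx.
by rewrite (lt_trans (_ : _ < 0)) ?invr_gt0 // ltrN10.
Qed.

Lemma power_sum1_le_ln N : (0 < N)%N -> power_sum (1 : R) N <= 1 + ln N%:R.
Proof.
case: N => // N _; elim: N => [|N IHN].
  by rewrite /power_sum big_ord1 powR1 ln1 addr0.
rewrite /power_sum big_ord_recr /= -/(power_sum 1 N.+1).
have N2 : 0 < N.+2%:R :> R by rewrite ltr0n.
apply: le_trans (lerD IHN (lexx _)) _; rewrite powR_inv1 //.
rewrite -addrA lerD2l -lerBrDr.
have -> : N.+1%:R = N.+2%:R * (1 - N.+2%:R^-1) :> R.
  by rewrite mulrBr mulr1 mulfV ?gt_eqF // -[N.+2%:R]natr1 addrK.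
have V1 : N.+2%:R^-1 < 1 :> R by rewrite invf_lt1 // ltr1n.
rewrite lnM ?posrE ?subr_gt0 // lerD2l; apply: le_ln1Dx.
by rewrite ltrN2.
Qed.

End PowerSums.

(** * Asymptotics *)

Lemma sum_ord_range (V : zmodType) (F : nat -> V) (m N K : nat) :
    (m <= N)%N -> (N <= K)%N ->
  \sum_(j < K | (m <= j < N)%N) F j = \sum_(j < N) F j - \sum_(j < m) F j.
Proof.
move=> mN NK; apply/eqP; rewrite eq_sym subr_eq; apply/eqP.
rewrite (big_ord_widen K F NK) (big_ord_widen K F (leq_trans mN NK)).
rewrite (bigID (fun j : 'I_K => (m <= j)%N)) /=; congr (_ + _).
  by apply: eq_bigl => j; rewrite andbC.
apply: eq_bigl => j; rewrite -ltnNge andbC; case: ltnP => //= jm.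
exact: leq_trans mN.
Qed.

Lemma half_leq_double (n j : nat) : (n./2 <= j)%N -> (n <= j.+1.*2)%N.
Proof. by lia. Qed.

Lemma leq_subn_half (n : nat) : (n <= 2 * (n - n./2))%N.
Proof. by lia. Qed.

Lemma leq_half (n : nat) : (n./2 <= n)%N.
Proof. by lia. Qed.

Lemma eqTheta_bounds (R : realType) (f g : nat -> R) (c C : R) :
    0 < c -> 0 < C ->
    (\forall s \near \oo, [/\ 0 <= g s, c * g s <= f s & f s <= C * g s]) ->
  f =Theta_\oo g.
Proof.
move=> c0 C0 H; rewrite eqThetaE; apply/asboolP.
exists (c, C); first by rewrite /= c0.
apply: filterS H => s [g0 cf fC].
have f0 : 0 <= f s by apply: le_trans cf; rewrite mulr_ge0 // ltW.
by rewrite !ger0_norm.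
Qed.

Lemma eqTheta_near (R : realType) (f g h : nat -> R) :
    f =Theta_\oo g -> (\forall s \near \oo, 0 <= h s /\ g s = h s) ->
  f =Theta_\oo h.
Proof.
move=> fg gh; apply: eqTheta_trans fg _.
apply: (@eqTheta_bounds _ _ _ 1 1) => //; apply: filterS gh => s [h0 ->].
by rewrite mul1r.
Qed.

Lemma eqTheta_le (R : realType) (f g : nat -> R) : f =Theta_\oo g ->
  exists2 C : R, 0 < C & \forall s \near \oo, `|f s| <= C * `|g s|.
Proof.
rewrite eqThetaE => /asboolP[[c C] /= /andP[_ C0] H].
by exists C => //; apply: filterS H => s [].
Qed.

(** Used with [H] the normalising sum of the Zipf law and [h] its closed-form order of growth. *)
Lemma eqTheta_denominator (R : realType) (A M H h : nat -> R) (lo hi : R) :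
    0 < lo -> 0 < hi ->
    (\forall s \near \oo, [/\ 0 <= A s, 0 < M s, 0 < h s,
        lo * h s <= H s & H s <= hi * h s]) ->
  (fun s => A s / Num.sqrt (M s * H s)) =Theta_\oo
  (fun s => A s / Num.sqrt (M s * h s)).
Proof.
move=> lo0 hi0 bnd.
apply: (@eqTheta_bounds _ _ _ (Num.sqrt hi)^-1 (Num.sqrt lo)^-1);
  rewrite ?invr_gt0 ?sqrtr_gt0 //.
apply: filterS bnd => s [A0 M0 h0 loH Hhi].
have H0 : 0 < H s by apply: lt_le_trans loH; rewrite mulr_gt0.
have key (x y z : R) : 0 < x -> 0 < y -> 0 < z -> x * y <= z ->
    (Num.sqrt (M s * z))^-1 <= (Num.sqrt x)^-1 / Num.sqrt (M s * y).
  move=> x0 y0 z0 xyz; rewrite -invfM -(sqrtrM _ (ltW x0)).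
  rewrite lef_pV2 ?posrE ?sqrtr_gt0 ?mulr_gt0 //.
  rewrite ler_sqrt; last by rewrite ltW // mulr_gt0.
  by rewrite mulrCA ler_pM2l.
split; first by rewrite divr_ge0 // sqrtr_ge0.
  rewrite mulrCA ler_wpM2l //.
  (* The lower bound is the upper one with [H] and [h] exchanged. *)
  have := key hi^-1 (H s) (h s).
  rewrite (sqrtrV (ltW hi0)) invrK ler_pdivrMl //.
  by rewrite ler_pdivrMl ?sqrtr_gt0 // invr_gt0; apply.
by rewrite mulrCA ler_wpM2l // key.
Qed.

(** * Elementary bounds on the Zipf law *)

Section Zipf.
Variables (R : realType) (gamma : R).

Lemma zipf_pop_gt0 (K : nat) (j : 'I_K) : 0 < zipf_pop gamma j.
Proof.
rewrite divr_gt0 ?powR_gt0 ?ltr0n //; apply: power_sum_gt0.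
exact: leq_ltn_trans (ltn_ord j).
Qed.

Lemma sum_zipf_pop (K : nat) : (0 < K)%N ->
  \sum_(j < K) zipf_pop gamma j = 1.
Proof. by move=> K0; rewrite -mulr_suml divff // gt_eqF // power_sum_gt0. Qed.

Lemma sqrt_zipf_pop (K : nat) (j : 'I_K) :
  Num.sqrt (zipf_pop gamma j) =
  j.+1%:R `^ (- (gamma / 2)) / Num.sqrt (power_sum gamma K).
Proof.
have K0 : (0 < K)%N by apply: leq_ltn_trans (ltn_ord j).
rewrite /zipf_pop sqrtrM ?powR_ge0 // sqrtrV ?(ltW (power_sum_gt0 _ K0)) //.
by rewrite -powR12_sqrt ?powR_ge0 // -powRrM mulNr.
Qed.

Lemma zipf_pop_le (K : nat) (j : 'I_K) :
  zipf_pop gamma j <= j.+1%:R `^ (- gamma).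
Proof.
have K0 : (0 < K)%N by apply: leq_ltn_trans (ltn_ord j).
rewrite ler_pdivrMr; last exact: power_sum_gt0.
by apply: ler_peMr; rewrite ?powR_ge0 // power_sum_ge1.
Qed.

(** The threshold [B = (m / e) ^ (1 / gamma)] is independent of [K] because the normalising sum is
    at least 1. *)
Lemma zipf_pop_small (m e : R) : 0 < gamma -> 0 < m -> 0 < e ->
  exists B : R, forall (K : nat) (j : 'I_K),
    B <= j.+1%:R -> m * zipf_pop gamma j <= e.
Proof.
move=> g0 m0 e0; have me0 : 0 < m / e by rewrite divr_gt0.
exists ((m / e) `^ gamma^-1) => K j Bj.
apply: le_trans (_ : m * j.+1%:R `^ (- gamma) <= _).
  by rewrite ler_pM2l // zipf_pop_le.
rewrite powRN ler_pdivrMr ?powR_gt0 ?ltr0n // mulrC -ler_pdivrMr //.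
have -> : m / e = ((m / e) `^ gamma^-1) `^ gamma.
  by rewrite -powRrM mulVf ?gt_eqF // powRr1 // ltW.
by apply: ge0_ler_powR; rewrite ?nnegrE ?powR_ge0 ?ler0n // ltW.
Qed.

End Zipf.

Lemma uniform_pop_zipf (R : realType) (K : nat) :
  @uniform_pop R K = @zipf_pop R 0 K.
Proof.
apply/funext => j; rewrite /uniform_pop /zipf_pop oppr0 powRr0 div1r.
by under eq_bigr do rewrite powRr0; rewrite sumr_const card_ord.
Qed.

(** * Order of the cost in each range of [gamma] *)

Section Asymptotics.
Variables (R : realType) (K M : nat -> nat).
Hypothesis M_gt0 : forall s : nat, (0 < M s)%N.
Hypothesis M_oK : (fun s => (M s)%:R : R) =o_\oo (fun s => (K s)%:R : R).

Lemma near_M_le (e : R) : 0 < e ->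
  \forall s \near \oo, (M s)%:R <= e * (K s)%:R.
Proof.
move=> e0; have /eqoP/(_ e e0) := M_oK.
by apply: filterS => s; rewrite !ger0_norm.
Qed.

(** Since [M s] is at least 1 and negligible before [K s], the library grows without bound. *)
Lemma near_K_ge (B : R) : \forall s \near \oo, B <= (K s)%:R.
Proof.
have e0 : 0 < (1 + `|B|)^-1 :> R by rewrite invr_gt0 ltr_wpDr.
apply: filterS (near_M_le e0) => s.
have M1 : 1 <= (M s)%:R :> R by rewrite ler1n.
rewrite ler_pdivlMl; last by rewrite ltr_wpDr.
move=> MK; apply: le_trans MK; apply: le_trans (ler_norm B) _.
have B0 := normr_ge0 B; nra.
Qed.

Section GammaLt2.
Variable gamma : R.
Hypothesis gamma_ge0 : 0 <= gamma.
Hypothesis gamma_lt2 : gamma < 2.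
Hypothesis lib : library_replicated (zipf_pop gamma) K M.
Hypothesis small : forall e : R, 0 < e -> \forall s \near \oo,
  forall j : 'I_(K s), (K s <= j.+1.*2)%N -> (M s)%:R * zipf_pop gamma j <= e.

(** The hypothesis [small] isolates the only point where the uniform law and bounded caches differ.
    The upper bound sums [sqrt p_j] as a power sum of exponent [gamma / 2 < 1]. *)
Lemma zipf_cost_lt2 :
  (fun s => comm_cost s (M s) (@zipf_pop R gamma (K s))) =Theta_\oo
  (fun s => (K s)%:R `^ (1 - gamma / 2)
            / Num.sqrt ((M s)%:R * power_sum gamma (K s))).
Proof.
have [c c0 near_c] := lib.
(* The lower bound on the cost asks for a constant at most 1. *)
pose c' := Num.min c 1.
have c'0 : 0 < c' by rewrite lt_min c0 ltr01.
have c'1 : c' <= 1 by rewrite ge_min lexx orbT.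
have c'c : c' <= c by rewrite ge_min lexx.
have c'8 : 0 < c' / 8 by rewrite divr_gt0.
have b0 : 0 < 1 - gamma / 2 by rewrite subr_gt0 ltr_pdivrMr // mul1r.
pose d := c / (1 + c).
have d0 : 0 < d by rewrite divr_gt0 // addr_gt0.
apply: (@eqTheta_bounds _ _ _ (c' / 12 * Num.sqrt (c' / 8) * 2^-1)
   (4 / d * (2 / (1 - gamma / 2)))).
- by rewrite !mulr_gt0 ?sqrtr_gt0 ?invr_gt0.
- by rewrite mulr_gt0 // divr_gt0.
near=> s.
have s0 : (0 < s)%N by near: s; exact: nbhs_infty_gt.
have K0 : (0 < K s)%N by rewrite -(ler_nat R); near: s; exact: near_K_ge.
have Kr0 : 0 < (K s)%:R :> R by rewrite ltr0n.
have psum := sum_zipf_pop gamma K0.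
have H0 : 0 < power_sum gamma (K s) by apply: power_sum_gt0.
set H := power_sum gamma (K s) in H0 *.
have sM0 : 0 < Num.sqrt (M s)%:R :> R by rewrite sqrtr_gt0 ltr0n.
have sH0 : 0 < Num.sqrt H by rewrite sqrtr_gt0.
have cs : forall j : 'I_(K s), c <= (s ^ 2)%:R * (M s)%:R * zipf_pop gamma j.
  by near: s.
have small_s : forall j : 'I_(K s), (K s <= j.+1.*2)%N ->
    (M s)%:R * zipf_pop gamma j <= c' / 8.
  by near: s; apply: small.
rewrite sqrtrM //; set X := (K s)%:R `^ _ / _.
have X0 : 0 <= X by rewrite divr_ge0 ?powR_ge0 // mulr_ge0 // sqrtr_ge0.
split => //.
  pose J (j : 'I_(K s)) := ((K s)./2 <= j < K s)%N.
  have J2 j : J j -> (K s <= j.+1.*2)%N by case/andP => /half_leq_double.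
  apply: le_trans (@comm_cost_ge R s (K s) (M s) _ s0 (M_gt0 s)
    (@zipf_pop_gt0 R gamma (K s)) psum c' J c'0 c'1 _ _); last 2 first.
  - by move=> j _; rewrite mulrA; apply: le_trans (cs j).
  - by move=> j /J2; apply: small_s.
  rewrite -[leLHS]mulrA ler_pM2l; last by rewrite mulr_gt0 ?sqrtr_gt0 ?divr_gt0.
  (* [y] is the square root of the smallest popularity; it bounds from below each of the at least
     [K s / 2] terms. *)
  pose y := (K s)%:R `^ (- (gamma / 2)) / Num.sqrt H.
  apply: le_trans (_ : (\sum_(j < K s | J j) y) / Num.sqrt (M s)%:R <= _).
    rewrite (sum_ord_range (fun=> y)) ?leq_half //.
    rewrite !sumr_const !card_ord -mulrnBr ?leq_half //.
    have -> : 2^-1 * X = (2^-1 * (K s)%:R * y) / Num.sqrt (M s)%:R.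
      rewrite /X /y powRD; last by rewrite (gt_eqF Kr0) implybT.
      rewrite powRr1 //.
      by field; rewrite !gt_eqF.
    rewrite ler_pM2r ?invr_gt0 // -[leRHS]mulr_natl ler_wpM2r //.
      by rewrite divr_ge0 ?powR_ge0 // ltW.
    by rewrite ler_pdivrMl // -natrM ler_nat leq_subn_half.
  rewrite ler_pM2r ?invr_gt0 //; apply: ler_sum => j _.
  rewrite sqrt_zipf_pop ler_pM2r ?invr_gt0 //.
  rewrite !powRN lef_pV2 ?posrE ?powR_gt0 ?ltr0n //.
  apply: ge0_ler_powR; rewrite ?nnegrE ?ler0n ?ler_nat ?ltn_ord //.
  by rewrite divr_ge0.
apply: le_trans (comm_cost_le s0 (M_gt0 s) (@zipf_pop_gt0 R gamma (K s)) psum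
  d0 (served_prob_ge s0 (@zipf_pop_gt0 R gamma (K s)) psum c0 cs)) _.
rewrite -[leRHS]mulrA ler_pM2l; last exact: divr_gt0.
under eq_bigr do rewrite sqrt_zipf_pop.
rewrite -mulr_suml -/H -/(power_sum (gamma / 2) (K s)).
have -> : 2 / (1 - gamma / 2) * X =
  2 / (1 - gamma / 2) * (K s)%:R `^ (1 - gamma / 2) / Num.sqrt H
    / Num.sqrt (M s)%:R.
  by rewrite /X -!mulrA -invfM [Num.sqrt H * _]mulrC.
rewrite !ler_pM2r ?invr_gt0 //; apply: power_sum_le; first by rewrite divr_ge0.
by rewrite -subr_gt0.
Unshelve. all: by end_near.
Qed.

End GammaLt2.

Section BoundedCaches.
Variables (gamma m : R).
Hypothesis gamma_gt0 : 0 < gamma.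
Hypothesis m_gt0 : 0 < m.
Hypothesis M_le : \forall s \near \oo, (M s)%:R <= m.

Lemma zipf_cost_gt0_lt2 : gamma < 2 ->
    library_replicated (zipf_pop gamma) K M ->
  (fun s => comm_cost s (M s) (@zipf_pop R gamma (K s))) =Theta_\oo
  (fun s => (K s)%:R `^ (1 - gamma / 2)
            / Num.sqrt ((M s)%:R * power_sum gamma (K s))).
Proof.
move=> g2 lib; apply: zipf_cost_lt2 => //; first exact: ltW.
move=> e e0; have [B small] := zipf_pop_small gamma_gt0 m_gt0 e0.
near=> s => j Kj.
apply: le_trans (small _ j _).
  by rewrite ler_pM2r ?zipf_pop_gt0 //; near: s.
have : B * 2 <= (K s)%:R by near: s; exact: near_K_ge.
move=> BK; rewrite -(ler_pM2r (@ltr0Sn R 1)); apply: le_trans BK _.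
by rewrite -natrM ler_nat muln2.
Unshelve. all: by end_near.
Qed.

(** The most popular file alone suffices: its popularity is the inverse of a bounded sum. *)
Let served_ge_sqr (s : nat) : 1 < gamma -> (0 < s)%N -> (0 < K s)%N ->
  (1 + (gamma - 1)^-1) ^- 2 <= served_prob s (M s) (@zipf_pop R gamma (K s)).
Proof.
move=> g1 s0 K0; have H0 := power_sum_gt0 gamma K0.
apply: le_trans (served_prob_ge_sqr s0 (M_gt0 s) (@zipf_pop_gt0 R gamma (K s))
  (sum_zipf_pop gamma K0) (Ordinal K0)).
rewrite /zipf_pop powR1 div1r exprVn.
have h1 : 0 < 1 + (gamma - 1)^-1 by rewrite addr_gt0 // invr_gt0 subr_gt0.
rewrite lef_pV2 ?posrE ?exprn_gt0 // lerXn2r ?nnegrE ?(ltW h1) ?(ltW H0) //.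
exact: power_sum_bounded.
Qed.

Lemma zipf_cost_gt2 : 2 < gamma ->
  (fun s => comm_cost s (M s) (@zipf_pop R gamma (K s))) =Theta_\oo
  (fun s => (Num.sqrt (M s)%:R)^-1).
Proof.
move=> g2; have g1 : 1 < gamma by apply: lt_trans g2; rewrite ltr1n.
have g21 : 1 < gamma / 2 by rewrite ltr_pdivlMr // mul1r.
pose h := 1 + (gamma - 1)^-1.
have h0 : 0 < h by rewrite addr_gt0 // invr_gt0 subr_gt0.
pose C := 1 + (gamma / 2 - 1)^-1.
have C0 : 0 < C by rewrite addr_gt0 // invr_gt0 subr_gt0.
have e0 : 0 < 1 / 8 :> R by rewrite divr_gt0.
have [B small] := zipf_pop_small gamma_gt0 m_gt0 e0.
(* The file of rank [i + 1 >= B] is rare enough for [M p <= 1 / 8], and its rank does not depend on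
   [s]. *)
pose i := Num.truncn `|B|.
have Bi : B <= i.+1%:R.
  apply: le_trans (ler_norm B) _.
  by have /andP[_ /ltW] := truncn_itv (normr_ge0 B).
pose q := i.+1%:R `^ (- gamma) / h.
have q0 : 0 < q by rewrite divr_gt0 ?powR_gt0 ?ltr0n.
have k0 : 0 < 1 / 12 * Num.sqrt (1 / 8) :> R by rewrite mulr_gt0 ?sqrtr_gt0 ?divr_gt0.
apply: (@eqTheta_bounds _ _ _ (1 / 12 * Num.sqrt (1 / 8) * Num.sqrt q)
   (4 / h ^- 2 * C)).
- by rewrite mulr_gt0 ?sqrtr_gt0.
- by rewrite mulr_gt0 // divr_gt0 // invr_gt0 exprn_gt0.
near=> s.
have s0 : (0 < s)%N by near: s; exact: nbhs_infty_gt.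
have iK : (i < K s)%N by rewrite -(ler_nat R); near: s; exact: near_K_ge.
have K0 : (0 < K s)%N by apply: leq_ltn_trans iK.
have H0 := power_sum_gt0 gamma K0.
have sM0 : 0 < Num.sqrt (M s)%:R :> R by rewrite sqrtr_gt0 ltr0n.
have psum := sum_zipf_pop gamma K0.
have p_gt0 := @zipf_pop_gt0 R gamma (K s) (Ordinal iK).
have qp : q <= zipf_pop gamma (Ordinal iK).
  rewrite /q /zipf_pop /= ler_pM2l ?powR_gt0 ?ltr0n // lef_pV2 ?posrE //.
  exact: power_sum_bounded.
have Mm : (M s)%:R <= m by near: s.
split; first by rewrite invr_ge0 ltW.
  apply: le_trans (@comm_cost_ge R s (K s) (M s) _ s0 (M_gt0 s)
    (@zipf_pop_gt0 R gamma (K s)) psum 1 (pred1 (Ordinal iK)) ltr01 (lexx 1) _ _);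
    last 2 first.
  - move=> _ /eqP ->.
    (* The popularity of this fixed file stays above [q], so [s ^ 2] servers eventually hold at
       least one copy on average. *)
    have sq : q^-1 <= s%:R by near: s; exact: nbhs_infty_ger.
    have : 1 <= s%:R * q by rewrite -ler_pdivrMr // div1r.
    move=> /le_trans; apply; apply: ler_pM => //; first exact: ltW.
      by rewrite ler_nat -mulnn leq_pmulr.
    by apply: le_trans qp _; apply: ler_peMl; [exact: ltW|rewrite ler1n].
  - move=> _ /eqP ->; apply: le_trans (small (K s) (Ordinal iK) Bi).
    by rewrite ler_pM2r.
  rewrite big_pred1_eq -[leLHS]mulrA ler_pM2l // ler_pM2r ?invr_gt0 //.
  by rewrite ler_sqrt // ltW.
have d0 : 0 < h ^- 2 by rewrite invr_gt0 exprn_gt0.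
apply: le_trans (comm_cost_le s0 (M_gt0 s) (@zipf_pop_gt0 R gamma (K s)) psum
  d0 (served_ge_sqr g1 s0 K0)) _.
rewrite -[leRHS]mulrA ler_pM2l ?divr_gt0 // ler_pM2r ?invr_gt0 //.
under eq_bigr do rewrite sqrt_zipf_pop.
rewrite -mulr_suml -/(power_sum (gamma / 2) (K s)).
rewrite ler_pdivrMr ?sqrtr_gt0 //; apply: le_trans (power_sum_bounded _ g21) _.
apply: ler_peMr; first exact: ltW.
by rewrite -sqrtr1 ler_sqrt ?power_sum_ge1 // ltW.
Unshelve. all: by end_near.
Qed.

(** The square roots of the popularities form a harmonic sum. Ranks up to [min (K, s)] are
    replicated enough, and [ln K = O(ln n)] makes the logarithm of this minimum comparable with
    [ln K]. *)
Lemma zipf_cost_eq2 : gamma = 2 ->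
    (fun s => ln (K s)%:R : R) =O_\oo (fun s => ln (s ^ 2)%:R : R) ->
  (fun s => comm_cost s (M s) (@zipf_pop R gamma (K s))) =Theta_\oo
  (fun s => ln (K s)%:R / Num.sqrt (M s)%:R).
Proof.
move=> g2 /eqO_exP[A A0 lnKs].
have g1 : 1 < gamma by rewrite g2 ltr1n.
have hE : 1 + (gamma - 1)^-1 = 2.
  have -> : gamma - 1 = 1 by rewrite g2; ring.
  by rewrite invr1; ring.
have e0 : 0 < 1 / 2 / 8 :> R by rewrite !divr_gt0.
have [B small] := zipf_pop_small gamma_gt0 m_gt0 e0.
pose i := Num.truncn `|B|.
have Bi : B <= i.+1%:R.
  apply: le_trans (ler_norm B) _.
  by have /andP[_ /ltW] := truncn_itv (normr_ge0 B).
pose k : R := 1 / 2 / 12 * Num.sqrt (1 / 2 / 8).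
have k0 : 0 < k by rewrite mulr_gt0 ?sqrtr_gt0 ?divr_gt0.
have s20 : 0 < Num.sqrt 2 :> R by rewrite sqrtr_gt0.
(* [a] covers both cases of [N = min (K, s)] below: [ln K = ln N], or
   [ln K <= A ln (s ^ 2) = 2 A ln N]. *)
pose a := 1 + 2 * A.
have a0 : 0 < a by rewrite addr_gt0 // mulr_gt0.
(* Once [N >= E], discarding the first [i] ranks removes at most half of [ln N]. *)
pose E := expR (2 * power_sum (1 : R) i).
apply: (@eqTheta_bounds _ _ _ (k * (a^-1 / 2 / Num.sqrt 2)) (4 / 2 ^- 2 * 2)).
- by rewrite mulr_gt0 ?divr_gt0 ?invr_gt0.
- by rewrite mulr_gt0 // divr_gt0 // invr_gt0 exprn_gt0.
near=> s.
have s0 : (0 < s)%N by near: s; exact: nbhs_infty_gt.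
have lt_is : (i < s)%N by near: s; exact: nbhs_infty_gt.
have iK : (i < K s)%N by rewrite -(ler_nat R); near: s; exact: near_K_ge.
have K0 : (0 < K s)%N by apply: leq_ltn_trans iK.
have Es : E <= s%:R by near: s; exact: nbhs_infty_ger.
have EK : E <= (K s)%:R by near: s; exact: near_K_ge.
have eK : expR 1 <= (K s)%:R :> R by near: s; exact: near_K_ge.
have lnK1 : 1 <= ln (K s)%:R :> R.
  by rewrite -[leLHS]expRK ler_ln ?posrE ?expR_gt0 ?ltr0n.
have H0 := power_sum_gt0 gamma K0.
have Hle2 : power_sum gamma (K s) <= 2 by rewrite -hE; exact: power_sum_bounded.
have sM0 : 0 < Num.sqrt (M s)%:R :> R by rewrite sqrtr_gt0 ltr0n.
have sH0 : 0 < Num.sqrt (power_sum gamma (K s)) by rewrite sqrtr_gt0.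
have psum := sum_zipf_pop gamma K0.
have Mm : (M s)%:R <= m by near: s.
have g22 : gamma / 2 = 1 by rewrite g2 divff.
split; first by rewrite divr_ge0 ?(ltW sM0) // (le_trans ler01).
  pose N := minn (K s) s.
  have N0 : (0 < N)%N by rewrite leq_min K0.
  have NK : (N <= K s)%N by rewrite geq_minl.
  have iN : (i <= N)%N by rewrite leq_min (ltnW iK) (ltnW lt_is).
  have lnN : 2 * power_sum 1 i <= ln N%:R :> R.
    rewrite -[leLHS]expRK ler_ln ?posrE ?expR_gt0 ?ltr0n // -/E.
    by rewrite /N; case: leqP.
  have lnN0 : 0 <= ln N%:R :> R by rewrite ln_ge0 // ler1n.
  have lnKN : ln (K s)%:R <= a * ln N%:R :> R.
    have [h|/ltnW h] := leqP (K s) s.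
      rewrite /N (minn_idPl h); apply: ler_peMl; first exact: (le_trans ler01).
      by rewrite lerDl mulr_ge0 // ltW.
    rewrite /N (minn_idPr h).
    have ls0 : 0 <= ln s%:R :> R by rewrite ln_ge0 // ler1n.
    have : `|ln (K s)%:R| <= A * `|ln (s ^ 2)%:R : R| by near: s.
    rewrite natrX lnXn ?ltr0n // (ger0_norm (le_trans ler01 lnK1)).
    rewrite ger0_norm ?mulrn_wge0 //.
    move=> /le_trans; apply; rewrite /a.
    have -> : A * (ln s%:R *+ 2) = 2 * A * ln s%:R by ring.
    by apply: ler_wpM2r => //; rewrite lerDr.
  pose J (j : 'I_(K s)) := (i <= j < N)%N.
  have hc0 : 0 < 1 / 2 :> R by rewrite divr_gt0.
  have hc1 : 1 / 2 <= 1 :> R by rewrite ler_pdivrMr // mul1r ler1n.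
  apply: le_trans (@comm_cost_ge R s (K s) (M s) _ s0 (M_gt0 s)
    (@zipf_pop_gt0 R gamma (K s)) psum (1 / 2) J hc0 hc1 _ _); last 2 first.
  - move=> j /andP[_ jN].
    have js : (j < s)%N by apply: leq_trans jN _; rewrite geq_minr.
    (* Hence [n p_j >= 1 / H >= 1 / 2], the normalising sum [H] being at most 2; this is the
       constant [1 / 2] used here. *)
    have js2 : (j.+1%:R : R) ^+ 2 <= (s ^ 2)%:R.
      by rewrite natrX lerXn2r ?nnegrE ?ler_nat.
    have j0 : 0 < (j.+1%:R : R) ^+ 2 by rewrite exprn_gt0.
    apply: le_trans (_ : (s ^ 2)%:R * zipf_pop gamma j <= _); last first.
      rewrite ler_pM2l ?ltr0n ?expn_gt0 ?s0 //.
      by apply: ler_peMl; [exact: ltW (zipf_pop_gt0 _ _)|rewrite ler1n].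
    rewrite /zipf_pop -/(power_sum gamma (K s)) mulrA ler_pdivlMr //.
    apply: le_trans (_ : 1 <= _); first by lra.
    rewrite g2 powRN powR_mulrn // ler_pdivlMr // mul1r //.
  - move=> j /andP[ij _]; apply: le_trans (small (K s) j _).
      by rewrite ler_pM2r ?zipf_pop_gt0.
    by apply: le_trans Bi _; rewrite ler_nat.
  rewrite -/k -[leLHS]mulrA ler_pM2l // mulrA ler_pM2r ?invr_gt0 //.
  under eq_bigr do rewrite sqrt_zipf_pop g22.
  rewrite -mulr_suml (sum_ord_range (fun j => j.+1%:R `^ (- 1)) iN NK).
  rewrite -/(power_sum 1 N) -/(power_sum 1 i).
  apply: le_trans (_ : (ln N%:R / 2) / Num.sqrt 2 <= _).
    have -> : a^-1 / 2 / Num.sqrt 2 * ln (K s)%:R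
       = (a^-1 * ln (K s)%:R) / 2 / Num.sqrt 2 by ring.
    by rewrite !ler_pM2r ?invr_gt0 // ler_pdivrMl.
  have lnH := power_sum1_ge_ln R N0.
  apply: ler_pM.
  - by rewrite divr_ge0.
  - by rewrite invr_ge0 ltW.
  - by lra.
  - by rewrite lef_pV2 ?posrE // ler_sqrt.
have d0 : 0 < 2 ^- 2 :> R by rewrite invr_gt0 exprn_gt0.
have served : 2 ^- 2 <= served_prob s (M s) (@zipf_pop R gamma (K s)).
  by rewrite -hE; exact: served_ge_sqr.
apply: le_trans (comm_cost_le s0 (M_gt0 s) (@zipf_pop_gt0 R gamma (K s)) psum
  d0 served) _.
rewrite -[leRHS]mulrA ler_pM2l ?divr_gt0 // mulrA ler_pM2r ?invr_gt0 //.
under eq_bigr do rewrite sqrt_zipf_pop g22.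
rewrite -mulr_suml -/(power_sum 1 (K s)) ler_pdivrMr //.
apply: le_trans (_ : 2 * ln (K s)%:R <= _).
  (* The additive 1 is absorbed by [1 <= ln K]. *)
  by apply: le_trans (power_sum1_le_ln R K0) _; lra.
apply: ler_peMr; first by rewrite mulr_ge0 // (le_trans ler01).
by rewrite -sqrtr1 ler_sqrt ?power_sum_ge1 // ltW.
Unshelve. all: by end_near.
Qed.

End BoundedCaches.

End Asymptotics.

(** The numerator is [sqrt (k * k ^ (1 - g))], so the factor [k ^ (1 - g)] cancels. *)
Lemma sqrt_div_powR (R : realType) (g k m : R) : 0 < k -> 0 < m ->
  k `^ (1 - g / 2) / Num.sqrt (m * k `^ (1 - g)) = Num.sqrt (k / m).
Proof.
move=> k0 m0; have kg0 : 0 < k `^ (1 - g) by apply: powR_gt0.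
have -> : k `^ (1 - g / 2) = Num.sqrt (k * k `^ (1 - g)).
  rewrite -powR12_sqrt; last by rewrite mulr_ge0 ?ltW.
  rewrite -{2}(powRr1 (ltW k0)) -powRD; last by rewrite (gt_eqF k0) implybT.
  by rewrite -powRrM; congr (_ `^ _); field.
rewrite -(sqrtrV (mulr_ge0 (ltW m0) (ltW kg0))).
rewrite -(sqrtrM _ (mulr_ge0 (ltW k0) (ltW kg0))); congr Num.sqrt.
by field; rewrite !gt_eqF.
Qed.

Theorem theorem3 (R : realType) (K M : nat -> nat)
    (M_gt0 : forall s : nat, (0 < M s)%N)
    (M_oK : (fun s => (M s)%:R : R) =o_\oo (fun s => (K s)%:R : R)) :
  (library_replicated (@uniform_pop R) K M ->
   (fun s => comm_cost s (M s) (@uniform_pop R (K s)))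
     =Theta_\oo (fun s => Num.sqrt ((K s)%:R / (M s)%:R)))
  /\
  (forall gamma : R, 0 < gamma ->
   (fun s => (M s)%:R : R) =Theta_\oo (fun=> 1 : R) ->
   [/\ (gamma < 1 ->
        library_replicated (zipf_pop gamma) K M ->
        (fun s => comm_cost s (M s) (@zipf_pop R gamma (K s)))
          =Theta_\oo (fun s => Num.sqrt ((K s)%:R / (M s)%:R))),
       (gamma = 1 ->
        library_replicated (zipf_pop gamma) K M ->
        (fun s => comm_cost s (M s) (@zipf_pop R gamma (K s)))
          =Theta_\oo
            (fun s => Num.sqrt ((K s)%:R / ((M s)%:R * ln (K s)%:R)))),
       (1 < gamma < 2 ->
        library_replicated (zipf_pop gamma) K M ->
        (fun s => comm_cost s (M s) (@zipf_pop R gamma (K s)))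
          =Theta_\oo
            (fun s => (K s)%:R `^ (1 - gamma / 2) / Num.sqrt (M s)%:R)),
       (gamma = 2 ->
        (fun s => ln (K s)%:R : R) =O_\oo (fun s => ln (s ^ 2)%:R : R) ->
        (fun s => comm_cost s (M s) (@zipf_pop R gamma (K s)))
          =Theta_\oo (fun s => ln (K s)%:R / Num.sqrt (M s)%:R))
     & (2 < gamma ->
        (fun s => comm_cost s (M s) (@zipf_pop R gamma (K s)))
          =Theta_\oo (fun s => (Num.sqrt (M s)%:R)^-1))]).
Proof.
have Kpos : \forall s \near \oo, (0 < K s)%N.
  have := @near_K_ge R K M M_gt0 M_oK 1.
  by apply: filterS => s; rewrite ler1n.
have Mr0 s : 0 < (M s)%:R :> R by rewrite ltr0n.
split=> [lib|gamma gamma0 /eqTheta_le[m m0 Mm]].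
  have Eu : @uniform_pop R = @zipf_pop R 0.
    by apply: boolp.functional_extensionality_dep => k; apply: uniform_pop_zipf.
  rewrite Eu in lib *.
  apply: eqTheta_near (zipf_cost_lt2 M_gt0 M_oK (lexx 0) _ lib _) _ => //.
    (* For the uniform law [M p_j] is [M / K], which tends to 0 by assumption. *)
    move=> e e0; apply: filterS2 Kpos (near_M_le M_oK e0) => s K0 MK j _.
    by rewrite -uniform_pop_zipf /uniform_pop ler_pdivrMr ?ltr0n.
  apply: filterS Kpos => s K0; split; first exact: sqrtr_ge0.
  rewrite -(sqrt_div_powR 0) ?ltr0n //; congr (_ / Num.sqrt (_ * _)).
  rewrite /power_sum; under eq_bigr do rewrite oppr0 powRr0.
  by rewrite sumr_const card_ord subr0 powRr1.
have {}Mm : \forall s \near \oo, (M s)%:R <= m.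
  by apply: filterS Mm => s; rewrite normr1 mulr1 ger0_norm.
(* The first three cases share one estimate and differ only in the order of the normalising sum:
   [K ^ (1 - gamma)], [ln K] and a constant. *)
split.
- move=> g1 lib; have g2 : gamma < 2 by apply: lt_trans g1 _; rewrite ltr1n.
  have g'0 : 0 < 1 - gamma by rewrite subr_gt0.
  apply: eqTheta_near (eqTheta_trans
    (zipf_cost_gt0_lt2 M_gt0 M_oK gamma0 m0 Mm g2 lib)
    (@eqTheta_denominator R _ _ _ (fun s => (K s)%:R `^ (1 - gamma)) 1
       (2 / (1 - gamma)) _ _ _)) _.
  + by [].
  + by rewrite divr_gt0.
  + apply: filterS Kpos => s K0; split.
    * exact: powR_ge0.
    * exact: Mr0.
    * by rewrite powR_gt0 ?ltr0n.
    * by rewrite mul1r power_sum_ge // ltW.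
    * by rewrite power_sum_le // ltW.
  + apply: filterS Kpos => s K0; split; first exact: sqrtr_ge0.
    by rewrite sqrt_div_powR ?ltr0n.
- move=> g1 lib; have g2 : gamma < 2 by rewrite g1 ltr1n.
  have Ke : \forall s \near \oo, 1 <= ln (K s)%:R :> R.
    apply: filterS (@near_K_ge R K M M_gt0 M_oK (expR 1)) => s Ks.
    rewrite -[leLHS]expRK ler_ln ?posrE ?expR_gt0 //.
    exact: lt_le_trans (expR_gt0 1) Ks.
  apply: eqTheta_near (eqTheta_trans
    (zipf_cost_gt0_lt2 M_gt0 M_oK gamma0 m0 Mm g2 lib)
    (@eqTheta_denominator R _ _ _ (fun s => ln (K s)%:R) 1 2 _ _ _)) _ => //.
  + apply: filterS2 Kpos Ke => s K0 lnK1; rewrite g1; split.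
    * exact: powR_ge0.
    * exact: Mr0.
    * exact: lt_le_trans lnK1.
    * by rewrite mul1r power_sum1_ge_ln.
    * by apply: le_trans (power_sum1_le_ln R K0) _; lra.
  + apply: filterS2 Kpos Ke => s K0 lnK1; split; first exact: sqrtr_ge0.
    have ln0 : 0 < ln (K s)%:R :> R by apply: lt_le_trans lnK1.
    rewrite (sqrtrM _ (ler0n R (K s))) sqrtrV; last by rewrite mulr_ge0 // ltW.
    congr (_ / _); rewrite -powR12_sqrt //; congr (_ `^ _).
    by rewrite g1; field.
- move=> /andP[g1 g2] lib.
  apply: eqTheta_near (eqTheta_trans
    (zipf_cost_gt0_lt2 M_gt0 M_oK gamma0 m0 Mm g2 lib)
    (@eqTheta_denominator R _ _ _ (fun=> 1) 1 (1 + (gamma - 1)^-1) _ _ _)) _ => //.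
  + by rewrite addr_gt0 // invr_gt0 subr_gt0.
  + apply: filterS Kpos => s K0; split.
    * exact: powR_ge0.
    * exact: Mr0.
    * exact: ltr01.
    * by rewrite mul1r power_sum_ge1.
    * by rewrite mulr1 power_sum_bounded.
  + apply: filterS Kpos => s K0.
    by rewrite mulr1 divr_ge0 ?powR_ge0 ?sqrtr_ge0.
- by move=> g2 lnK; apply: (zipf_cost_eq2 M_gt0 M_oK gamma0 m0 Mm g2 lnK).
- by move=> g2; apply: (zipf_cost_gt2 M_gt0 M_oK gamma0 m0 Mm g2).
Qed.
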